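(* Let $b\ge2$ be an integer. If $n=n_1n_2\ldots n_k|_b$, with $0\le n_i\le b-1$, then $$p_b(n)=\frac12\sum_{S\subseteq\{1,\ldots,k\}}(-1)^{|S|}\,2^{\prod_{i=1}^{k}(n_i+\epsilon_i)},$$ where, for each $S$, $\epsilon_i=0$ if $i\in S$ and $\epsilon_i=1$ if $i\notin S$.
   Context: $n=n_1n_2\ldots n_k|_b$ denotes the number with base $b$ digits $n_1,\ldots,n_k$. The base $b$ dismal sum $\oplus_b$ of nonnegative integers is the number obtained by taking the digitwise maximum of their base $b$ expansions (padded with leading zeros). $p_b(n)$ is the number of ways of writing $n=m_1\oplus_b m_2\oplus_b\cdots\oplus_b m_l$ for some $l\ge1$ and distinct positive integers $m_i$, without regard to the order of summation; $p_b(0)=1$ by convention.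
   Formalization: The formula is stated for n ≥ 1 only: for n = 0 with k ≥ 1 (all digits zero) the right-hand side equals 1/2, whereas p_b(0) = 1 by convention. *)

(* Defs.v *)
From mathcomp Require Import all_boot.
From mathcomp Require Import finmap boolp classical_sets functions cardinality.

Set Implicit Arguments.
Unset Strict Implicit.
Unset Printing Implicit Defensive.

Local Open Scope nat_scope.

(* Most significant digit first: [d ord0] is the leading digit, which may
   be 0. *)
Definition from_digits (b k : nat) (d : 'I_k -> nat) : nat :=
  \sum_(i < k) d i * b ^ (k - i.+1).

(* The digit of weight [b ^ j], i.e. counted from the least significant. *)
Definition digit (b n j : nat) : nat := (n %/ b ^ j) %% b.

(* For [1 < b] the digits of [m] of index at least [m] vanish, since
   [m < b ^ m]; hence the bound of the sum (see [digit_dismal_add]). *)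
Definition dismal_add (b m n : nat) : nat :=
  \sum_(j < maxn m n) maxn (digit b m j) (digit b n j) * b ^ j.

(* For [1 < b] the enumeration order of [M] is irrelevant
   (see [digit_dismal_sum]). *)
Definition dismal_sum (b : nat) (M : {fset nat}) : nat :=
  \big[dismal_add b/0]_(m <- M) m.

(* Unordered sums of l >= 1 distinct positive integers are encoded as
   nonempty finite sets of positive integers. *)
Definition dismal_partitions (b n : nat) : set {fset nat} :=
  [set M : {fset nat} | [/\ M != fset0, (forall m, m \in M -> 0 < m)
                          & dismal_sum b M = n]]%classic.

(* [fset_set] returns the empty set on infinite sets; for [1 < b] this does
   not occur, by [finite_dismal_partitions]. The value 1 at [n = 0] is a
   convention: 0 has no dismal partition. *)
Definition dismal_p (b n : nat) : nat :=
  if n == 0 then 1 else #|` fset_set (dismal_partitions b n)|%fset.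

Section Theory.
Variable b : nat.
Hypothesis b_gt1 : 1 < b.

Let b_gt0 : 0 < b. Proof. exact: ltnW. Qed.

Lemma ltn_digit n j : digit b n j < b.
Proof. by rewrite ltn_mod. Qed.

Lemma digit_small n j : n < b ^ j -> digit b n j = 0.
Proof. by move=> h; rewrite /digit divn_small // mod0n. Qed.

Lemma modn_digits n N : n %% b ^ N = \sum_(i < N) digit b n i * b ^ i.
Proof.
elim: N => [|N IH]; first by rewrite big_ord0 expn0 modn1.
rewrite big_ord_recr /= -IH {1}(divn_eq n (b ^ N)) {1}(divn_eq (n %/ b ^ N) b).
rewrite -/(digit b n N) mulnDl -mulnA -expnS -addnA modnMDl addnC modn_small //.
have hr : n %% b ^ N < b ^ N by rewrite ltn_mod expn_gt0 b_gt0.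
apply: (@leq_trans ((digit b n N).+1 * b ^ N)); first by rewrite mulSn ltn_add2r.
by rewrite expnS leq_mul2r ltn_digit orbT.
Qed.

Lemma digits_lt (f : nat -> nat) N : (forall i, f i < b) ->
  \sum_(i < N) f i * b ^ i < b ^ N.
Proof.
move=> fb; elim: N => [|N IH]; first by rewrite big_ord0.
rewrite big_ord_recr /=.
apply: (@leq_trans ((f N).+1 * b ^ N)); first by rewrite mulSn ltn_add2r.
by rewrite expnS leq_mul2r fb orbT.
Qed.

Lemma digit_sum (f : nat -> nat) N j : (forall i, f i < b) ->
  digit b (\sum_(i < N) f i * b ^ i) j = if j < N then f j else 0.
Proof.
move=> fb; case: ltnP => [ltjN|leNj]; last first.
  by apply: digit_small; apply: leq_trans (digits_lt N fb) _; rewrite leq_exp2l.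
elim: N ltjN => // N IH; rewrite ltnS leq_eqVlt => /orP[/eqP->|ltjN].
  rewrite big_ord_recr /= /digit divnDMl ?expn_gt0 ?b_gt0 //.
  by rewrite divn_small ?digits_lt // add0n modn_small.
have e : f N * b ^ N = f N * b ^ (N - j.+1) * b * b ^ j.
  by rewrite -!mulnA -expnS -expnD subnK.
by rewrite big_ord_recr /= -[RHS]IH // /digit e divnDMl ?expn_gt0 ?b_gt0 // addnC modnMDl.
Qed.

Lemma digit_dismal_add m n j :
  digit b (dismal_add b m n) j = maxn (digit b m j) (digit b n j).
Proof.
rewrite (digit_sum (f := fun j => maxn (digit b m j) (digit b n j))); last first.
  by move=> i; rewrite gtn_max !ltn_digit.
case: ltnP => //; rewrite geq_max => /andP[hm hn].
have pj : j < b ^ j by exact: ltn_expl.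
by rewrite (digit_small (leq_ltn_trans hm pj)) (digit_small (leq_ltn_trans hn pj)).
Qed.

Lemma digit_dismal_sum (M : {fset nat}) j :
  digit b (dismal_sum b M) j = \max_(m <- M) digit b m j.
Proof.
rewrite /dismal_sum; elim: (enum_fset M) => [|m s IH].
  by rewrite !big_nil /digit div0n mod0n.
by rewrite !big_cons digit_dismal_add IH.
Qed.

Lemma leq_digits m n : (forall j, digit b m j <= digit b n j) -> m <= n.
Proof.
move=> h; pose N := maxn m n.
have hm : m < b ^ N.
  by apply: leq_trans (ltn_expl m b_gt1) _; rewrite leq_exp2l ?leq_maxl.
have hn : n < b ^ N.
  by apply: leq_trans (ltn_expl n b_gt1) _; rewrite leq_exp2l ?leq_maxr.
have : m %% b ^ N <= n %% b ^ N; last by rewrite !modn_small.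
rewrite !modn_digits.
by apply: leq_sum => i _; rewrite leq_mul2r h orbT.
Qed.

Lemma finite_dismal_partitions n : finite_set (dismal_partitions b n).
Proof.
apply: (@sub_finite_set _ _ [set` fpowerset [fset i in iota 0 n.+1]%fset]);
  last exact: finite_fset.
move=> M [_ _ Mn]; rewrite mksetE fpowersetE; apply/fsubsetP => m mM.
rewrite in_fset; change (m \in iota 0 n.+1).
rewrite mem_iota add0n ltnS; apply: leq_digits => j.
rewrite -Mn digit_dismal_sum.
by apply: (@leq_bigmax_seq _ _ xpredT (fun i => digit b i j) m).
Qed.

End Theory.

(* Main.v *)
Require Import Defs.
From mathcomp Require Import finmap boolp classical_sets cardinality.
From mathcomp Require Import all_boot all_order all_algebra.

Set Implicit Arguments.
Unset Strict Implicit.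
Unset Printing Implicit Defensive.

Import GRing.Theory.
Local Open Scope ring_scope.

(** Replace a number by the vector of its [k] digits. A set [M] of digit vectors
    has dismal sum [d] exactly when the coordinatewise maximum of [M] is [d]:
    every member of [M] is coordinatewise at most [d], and for each position
    [i] some member reaches [d i] ([dismal_sumP], [spans_codesP]).

    The second condition is the negation, for every [i], of the property
    P_i that all members of [M] are smaller than [d i] in position [i]. Among
    the sets [M] of vectors bounded by [d], those that satisfy P_i for all [i]
    in [S] are the subsets of a box with [d i] choices in the positions of [S]
    and [d i + 1] choices elsewhere ([card_box]), so there are two to the power
    of the product of these numbers of them. Inclusion-exclusion over [S] gives
    the alternating sum of the theorem ([card_spans]).

    That sum allows the vector 0 in [M], while the summands of a dismal
    partition are positive. Since [d] is not 0, adding 0 to [M] or removing it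
    from [M] does not change whether [M] reaches [d] ([spans_setU1]), so exactly
    half of the sets counted omit 0 ([card_toggle]); this is the factor 1/2.
    The sets omitting 0 correspond to the dismal partitions
    ([dismal_partitions_codes]). *)

(** * Counting subsets *)

(** Expanding the product of the factors 1 - [P i x] over [i] gives the
    alternating sum over [S] of the indicators of the intersections of the
    [P i]; summing over [x] in [A] gives the claim. *)
Lemma inclusion_exclusion (R : comNzRingType) (T I : finType)
    (P : I -> pred T) (A : {set T}) :
  \sum_(S : {set I}) (-1) ^+ #|S| *
      #|[set x in A | [forall i in S, P i x]]|%:R
    = #|[set x in A | [forall i, ~~ P i x]]|%:R :> R.
Proof.
(* Cardinals and universal quantifiers become sums and products of 0-1 values
   in R, where distributivity applies. *)
have cardR (Q : pred T) :
    #|[set x in A | Q x]|%:R = \sum_(x in A) (Q x)%:R :> R.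
  rewrite -sum1_card natr_sum (eq_bigl (fun x => (x \in A) && Q x)).
    by rewrite big_mkcondr; apply: eq_bigr => x _; case: (Q x).
  by move=> x; rewrite inE.
have forallR (S : pred I) (Q : pred I) :
    [forall (i | S i), Q i]%:R = \prod_(i | S i) (Q i)%:R :> R.
  rewrite -big_andE; apply: (big_morph (fun c : bool => c%:R : R)) => //.
  by case=> c; rewrite ?mul1r ?mul0r.
under eq_bigr do rewrite cardR mulr_sumr.
rewrite exchange_big cardR; apply: eq_bigr => x _ /=.
have negE i : (~~ P i x)%:R = - (P i x)%:R + 1 :> R.
  by case: (P i x); rewrite ?addNr ?oppr0 ?add0r.
have -> : [forall i, ~~ P i x] = [forall (i | xpredT i), ~~ P i x] by [].
rewrite forallR (eq_bigr _ (fun i _ => negE i)).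
rewrite bigA_distr; apply: eq_big => // S _.
by rewrite forallR -big_mkcond /= prodrN.
Qed.

Local Open Scope nat_scope.

(** Adding [z] matches the sets without [z] with the sets containing [z], and by
    hypothesis it respects [P]. *)
Lemma card_toggle (T : finType) (P : pred {set T}) (z : T) :
  (forall M, P (z |: M) = P M) ->
  #|[set M | P M]| = (#|[set M | P M & z \notin M]|).*2.
Proof.
move=> Pz; rewrite -addnn -(cardsID [set M : {set T} | z \in M]); congr (_ + _).
  rewrite -(card_in_imset (f := fun M => z |: M)
                          (D := [set M | P M & z \notin M])).
    apply: eq_card => M; rewrite !inE; apply/andP/imsetP => [[PM zM]|[N + ->]].
      exists (M :\ z); last by rewrite setD1K.
      by rewrite !inE eqxx -Pz setD1K ?PM.
    by rewrite inE Pz setU11 => /andP[].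
  move=> M N; rewrite !inE => /andP[_ zM] /andP[_ zN] e.
  by rewrite -(setU1K zM) e setU1K.
by apply: eq_card => M; rewrite !inE andbC.
Qed.

(** * Dismal sums and digits *)

(** Non-emptiness is needed for the witnesses: the dismal sum of the empty set is
    0 by convention, although nothing reaches the digits of 0. *)
Lemma dismal_sumP (b n : nat) (M : {fset nat}) : 1 < b -> M != fset0 ->
  dismal_sum b M = n <->
  (forall m j, m \in M -> digit b m j <= digit b n j) /\
  (forall j, exists2 m, m \in M & digit b n j <= digit b m j).
Proof.
move=> b_gt1 /fset0Pn[m0 m0M]; split=> [<-|[le_n ge_n]].
  split=> [m j mM|j]; rewrite digit_dismal_sum //.
    exact: (leq_bigmax_seq (F := fun m => digit b m j) m).
  apply: contrapT => noM.
  (* If no member attained the maximum, all would be at most its predecessor. *)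
  have M_lt m : m \in M -> digit b m j < \max_(m <- M) digit b m j.
    by move=> mM; rewrite ltnNge; apply/negP => h; apply: noM; exists m.
  have max_gt0 := leq_ltn_trans (leq0n _) (M_lt _ m0M).
  have: \max_(m <- M) digit b m j <= (\max_(m <- M) digit b m j).-1.
    by apply/bigmax_leqP_seq => m /M_lt lt_m _; rewrite -ltnS prednK.
  by rewrite leqNgt prednK // leqnn.
have e j : digit b (dismal_sum b M) j = digit b n j.
  rewrite digit_dismal_sum //; apply/eqP; rewrite eqn_leq; apply/andP; split.
    by apply/bigmax_leqP_seq => m mM _; apply: le_n.
  have [m mM le_m] := ge_n j.
  exact: (bigmaxn_sup_seq m).
by apply/eqP; rewrite eqn_leq; apply/andP; split; apply: (leq_digits b_gt1) => j;
  rewrite e.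
Qed.

Section Digits.
Variables (b k : nat).
Hypothesis b_gt1 : 1 < b.

(** Digit vectors list the leading digit first, whereas [digit] counts from the
    least significant one; [rev_ord] translates between the two conventions. *)
Lemma from_digits_rev (f : nat -> nat) :
  from_digits b (fun i : 'I_k => f (rev_ord i)) = \sum_(j < k) f j * b ^ j.
Proof. by rewrite [RHS](reindex_inj rev_ord_inj). Qed.

Lemma from_digits_digit m : m < b ^ k ->
  from_digits b (fun i : 'I_k => digit b m (rev_ord i)) = m.
Proof. by move=> m_lt; rewrite from_digits_rev -modn_digits ?modn_small. Qed.

Variable d : 'I_k -> nat.
Hypothesis d_lt : forall i, d i < b.

(* The digits indexed by weight and extended by 0, the form in which sums of
   weighted digits are indexed by natural numbers. *)
Let f j := if insub j is Some i then d (rev_ord i) else 0.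

Let f_lt j : f j < b.
Proof. by rewrite /f; case: insub => //; apply: ltnW. Qed.

Let from_digitsE : from_digits b d = \sum_(j < k) f j * b ^ j.
Proof.
rewrite -from_digits_rev; apply: eq_bigr => i _.
by rewrite /f valK rev_ordK.
Qed.

Lemma digit_from_digits i : digit b (from_digits b d) (rev_ord i) = d i.
Proof. by rewrite from_digitsE digit_sum // ltn_ord /f valK rev_ordK. Qed.

Lemma from_digits_lt : from_digits b d < b ^ k.
Proof. by rewrite from_digitsE digits_lt. Qed.

End Digits.

(** * Sets of digit vectors reaching given digits *)

(** The bound has the same shape as the factors of the counting formula: a
    coordinate is at most [d i] in general, and smaller than [d i] on [S]. *)
Definition box (b k : nat) (d : 'I_k -> nat) (S : {set 'I_k}) :
    {set {ffun 'I_k -> 'I_b}} :=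
  [set x : {ffun 'I_k -> 'I_b} |
     [forall i, x i < d i + (if i \in S then 0 else 1)]].

Lemma card_box (b k : nat) (d : 'I_k -> nat) (S : {set 'I_k}) :
  (forall i, d i < b) ->
  #|box b d S| = \prod_(i < k) (d i + (if i \in S then 0 else 1)).
Proof.
move=> d_lt.
pose F (i : 'I_k) : pred 'I_b := fun y => y < d i + (if i \in S then 0 else 1).
rewrite (eq_card (B := family F)); last by move=> x; rewrite inE.
rewrite card_family foldrE big_map big_enum /=; apply: eq_bigr => i _.
rewrite -sum1_card /=; set e := d i + _.
(* Since e is at most b, the condition y < e cuts out exactly e elements. *)
have e_le : e <= b by rewrite /e; case: (i \in S); rewrite ?addn0 ?addn1 // ltnW.
by rewrite -[RHS]card_ord -sum1_card (big_ord_widen _ (fun=> 1) e_le).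
Qed.

(** The coordinatewise maximum of [M] is [d], with [M] non-empty as soon as
    there is a coordinate at all. *)
Definition spans (b k : nat) (d : 'I_k -> nat) : pred {set {ffun 'I_k -> 'I_b}} :=
  fun M => (M \subset box b d set0) && [forall i, exists x in M, d i <= x i].

Lemma spansP (b k : nat) (d : 'I_k -> nat) (M : {set {ffun 'I_k -> 'I_b}}) :
  reflect ((forall x i, x \in M -> x i <= d i) /\
           (forall i, exists2 x : {ffun 'I_k -> 'I_b}, x \in M & d i <= x i))
          (spans d M).
Proof.
apply: (iffP andP) => -[le_d ge_d]; split.
- move=> x i /(subsetP le_d); rewrite inE => /forallP/(_ i).
  by rewrite inE addn1 ltnS.
- by move=> i; have /forallP/(_ i)/exists_inP := ge_d.
- apply/subsetP => x xM; rewrite inE; apply/forallP => i.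
  by rewrite inE addn1 ltnS le_d.
- by apply/forallP => i; apply/exists_inP/ge_d.
Qed.

(** The zero vector can reach [d] only in positions where [d] vanishes, and there
    any other member of [M] does as well. A position with [d i] positive
    guarantees that [M] has such a member. *)
Lemma spans_setU1 (b k : nat) (d : 'I_k -> nat) (z : {ffun 'I_k -> 'I_b}) M :
  (exists i, 0 < d i) -> (forall i, z i = 0 :> nat) ->
  spans d (z |: M) = spans d M.
Proof.
move=> [i0 d_gt0] z0; apply/spansP/spansP => -[le_d ge_d]; split.
- by move=> x i xM; apply: le_d; rewrite setU1r.
- have [y yM dy] : exists2 y : {ffun _}, y \in M & d i0 <= y i0.
    have [y /setU1P[->|yM] dy] := ge_d i0; last by exists y.
    by move: dy; rewrite z0 leqNgt d_gt0.
  move=> i; have [x /setU1P[->|xM] dx] := ge_d i; last by exists x.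
  by exists y => //; rewrite (leq_trans dx) ?z0.
- by move=> x i /setU1P[->|/le_d//]; rewrite z0.
- by move=> i; have [x xM dx] := ge_d i; exists x; rewrite ?setU1r.
Qed.

(** Inclusion-exclusion on the subsets of the full box, for the properties that
    all members stay below [d i] in position [i]. Where [d i] is 0 only the
    empty set has that property, in accordance with the term [2 ^+ 0] that
    the formula contributes. *)
Lemma card_spans (b k : nat) (d : 'I_k -> nat) :
  (forall i, d i < b) ->
  (#|[set M | @spans b k d M]|%:R =
    \sum_(S : {set 'I_k}) (-1) ^+ #|S| *
      2 ^+ (\prod_(i < k) (d i + (if i \in S then 0 else 1)))%N :> rat)%R.
Proof.
move=> d_lt.
pose P (i : 'I_k) (M : {set {ffun 'I_k -> 'I_b}}) := [forall x in M, x i < d i].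
transitivity
  ((#|[set M in powerset (box b d set0) | [forall i, ~~ P i M]]|)%:R : rat)%R.
  congr (_%:R)%R; apply: eq_card => M; rewrite !inE /spans; congr (_ && _).
  apply: eq_forallb => i; rewrite /P negb_forall_in.
  by apply: eq_existsb => x; rewrite -leqNgt.
rewrite -inclusion_exclusion; apply: eq_bigr => S _; congr (_ * _)%R.
rewrite -(card_box _ d_lt) -natrX -card_powerset; congr (_%:R)%R.
apply: eq_card => M; rewrite !inE.
apply/andP/subsetP => [[/subsetP M_box /forall_inP M_S] x xM|M_box].
  have := M_box x xM; rewrite !inE => /forallP x_le; apply/forallP => i.
  have := x_le i; rewrite inE; case: ifP => // iS _.
  by have /forall_inP/(_ x xM) := M_S i iS; rewrite addn0.
split.
  apply/subsetP => x /M_box; rewrite !inE => /forallP x_le; apply/forallP => i.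
  by rewrite inE (leq_trans (x_le i)) // leq_add2l; case: ifP.
apply/forall_inP => i iS; apply/forall_inP => x /M_box; rewrite inE.
by move=> /forallP/(_ i); rewrite iS addn0.
Qed.

(** * Dismal partitions as sets of digit vectors *)

Section Coding.
Variables (b k : nat) (d : 'I_k -> nat).
Hypothesis b_gt1 : 1 < b.
Hypothesis d_lt : forall i, d i < b.

Let V := {ffun 'I_k -> 'I_b}.

Definition code (x : {ffun 'I_k -> 'I_b}) : nat := from_digits b (fun i => x i).

Lemma digit_code x i : digit b (code x) (rev_ord i) = x i.
Proof. by apply: (digit_from_digits b_gt1 (d := fun i => x i)). Qed.

Lemma code_inj : injective code.
Proof.
move=> x y e; apply/ffunP => i; apply: val_inj.
by rewrite -[LHS]digit_code -[RHS]digit_code e.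
Qed.

Lemma code_surj m : m < b ^ k -> exists x, m = code x.
Proof.
move=> m_lt.
pose x : V := [ffun i => Ordinal (ltn_digit b_gt1 m (rev_ord (i : 'I_k)))].
exists x; rewrite -[LHS](from_digits_digit b_gt1 m_lt).
by apply: eq_bigr => i _; rewrite ffunE.
Qed.

Definition codes (M : {set {ffun 'I_k -> 'I_b}}) : {fset nat} :=
  [fset code x | x in M]%fset.

Lemma codes_inj : injective codes.
Proof.
have sub M N : codes M = codes N -> M \subset N.
  move=> e; apply/subsetP => x xM.
  have: code x \in codes N by rewrite -e; apply: in_imfset.
  by case/imfsetP => y yN /code_inj ->.
by move=> M N e; apply/eqP; rewrite eqEsubset !sub.
Qed.

(** Positions of weight at least [b ^ k] carry only zeros on both sides, so
    comparing the [k] given digits is enough. *)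
Lemma spans_codesP M : M != set0 ->
  spans d M <-> dismal_sum b (codes M) = from_digits b d.
Proof.
move=> /set0Pn[x0 x0M].
have codes_n0 : codes M != fset0.
  by apply/fset0Pn; exists (code x0); apply: in_imfset.
have big_digit n j : n < b ^ k -> k <= j -> digit b n j = 0.
  by move=> n_lt le_kj; apply/digit_small/(leq_trans n_lt); rewrite leq_exp2l.
have code_lt x : code x < b ^ k by apply: from_digits_lt.
rewrite dismal_sumP //; split=> [/spansP[le_d ge_d]|[le_d ge_d]].
  split=> [m j /imfsetP[x xM ->]|j].
    have [lt_jk|le_kj] := ltnP j k; last by rewrite big_digit.
    rewrite -[j]/(val (Ordinal lt_jk)) -[Ordinal lt_jk]rev_ordK.
    by rewrite digit_code digit_from_digits // le_d.
  have [lt_jk|le_kj] := ltnP j k; last first.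
    by exists (code x0); [apply: in_imfset | rewrite !big_digit ?from_digits_lt].
  rewrite -[j]/(val (Ordinal lt_jk)) -[Ordinal lt_jk]rev_ordK.
  have [x xM dx] := ge_d (rev_ord (Ordinal lt_jk)).
  exists (code x); first exact: in_imfset.
  by rewrite digit_code digit_from_digits.
apply/spansP; split=> [x i xM|i].
  rewrite -digit_code -(digit_from_digits b_gt1 d_lt i).
  by apply: le_d; apply: in_imfset.
have [m /imfsetP[x xM ->]] := ge_d (rev_ord i).
by rewrite digit_code digit_from_digits // => dx; exists x.
Qed.

(** Every summand of a dismal partition is bounded by the sum, hence has at most
    [k] digits and comes from a digit vector. Positivity of the summands means
    that the zero vector [z] is left out. *)
Lemma dismal_partitions_codes (z : {ffun 'I_k -> 'I_b}) :
  (forall i, z i = 0 :> nat) -> 0 < from_digits b d ->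
  fset_set (dismal_partitions b (from_digits b d)) =
  [fset codes M | M in [set M | spans d M & z \notin M]%SET]%fset.
Proof.
move=> z0 n_gt0.
have code_z : code z = 0 by rewrite /code /from_digits big1 // => i _; rewrite z0.
have code_gt0 x : (0 < code x) = (x != z).
  by rewrite lt0n -code_z (inj_eq code_inj).
apply/fsetP => A; rewrite in_fset_set; last exact: finite_dismal_partitions.
apply/idP/imfsetP => /= [|[M + ->]].
  move/set_mem => -[A_n0 A_gt0 A_sum].
  have A_lt m : m \in A -> m < b ^ k.
    move=> mA; apply: leq_ltn_trans (from_digits_lt b_gt1 d_lt).
    have [le_d _] := (dismal_sumP _ b_gt1 A_n0).1 A_sum.
    by apply: (leq_digits b_gt1) => j; apply: le_d.
  pose M := [set x : V | code x \in A].
  have eA : A = codes M.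
    apply/fsetP => m; apply/idP/imfsetP => [mA|[x + ->]]; last by rewrite /= inE.
    have [x ex] := code_surj (A_lt m mA).
    by exists x => //; rewrite /= inE -ex.
  exists M => //; rewrite inE; apply/andP; split.
    apply/spans_codesP; last by rewrite -eA.
    have /fset0Pn[m mA] := A_n0; have [x ex] := code_surj (A_lt m mA).
    by apply/set0Pn; exists x; rewrite inE -ex.
  by rewrite inE; apply/negP => /A_gt0; rewrite code_z.
rewrite inE => /andP[M_d zM].
have M_n0 : M != set0.
  apply: contraTneq n_gt0 => M0; rewrite -leqNgt leqn0 /from_digits.
  rewrite big1 // => i _; have /spansP[_ /(_ i)[x]] := M_d.
  by rewrite M0 inE.
apply/mem_set; split; last exact/spans_codesP.
  by have /set0Pn[x xM] := M_n0; apply/fset0Pn; exists (code x); apply: in_imfset.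
move=> m /imfsetP[x /= xM ->]; rewrite code_gt0.
by apply: contraNneq zM => <-.
Qed.

Lemma card_dismal_partitions (z : {ffun 'I_k -> 'I_b}) :
  (forall i, z i = 0 :> nat) -> 0 < from_digits b d ->
  dismal_p b (from_digits b d) = #|[set M | spans d M & z \notin M]|.
Proof.
move=> z0 n_gt0; rewrite /dismal_p gtn_eqF // (dismal_partitions_codes z0) //.
rewrite card_imfset /=; last exact: codes_inj.
by rewrite cardE.
Qed.

End Coding.

Local Open Scope ring_scope.

Theorem theorem23 (b k : nat) (d : 'I_k -> nat) (n : nat)
    (b_ge2 : (2 <= b)%N)
    (d_digit : forall i : 'I_k, (d i <= b - 1)%N)
    (n_digits : n = from_digits b d)
    (n_gt0 : (0 < n)%N) :
  (dismal_p b n)%:R =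
    1 / 2 * \sum_(S : {set 'I_k})
      (-1) ^+ #|S| *
      2 ^+ (\prod_(i < k) (d i + (if i \in S then 0 else 1)))%N :> rat.
Proof.
have d_lt i : (d i < b)%N.
  by rewrite (leq_ltn_trans (d_digit i)) // subn1 prednK // ltnW.
pose z : {ffun 'I_k -> 'I_b} := [ffun=> Ordinal (ltnW b_ge2)].
have z0 i : z i = 0%N :> nat by rewrite ffunE.
have d_gt0 : exists i, (0 < d i)%N.
  apply: contrapT => d0; move: n_gt0; rewrite n_digits /from_digits big1 // => i _.
  by case: (posnP (d i)) => [->|di] //; case: d0; exists i.
rewrite -(card_spans d_lt) n_digits.
rewrite (card_dismal_partitions b_ge2 d_lt z0) -?n_digits //.
rewrite (@card_toggle _ (spans d) z); last by move=> M; apply: spans_setU1.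
by rewrite -mul2n natrM mulrA mul1r mulVf ?mul1r.
Qed.
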